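(* Let $B(z)=\dfrac{1}{1-\log(1+z)}$ for $z\in\mathbb{D}$, and let $a$ be a real number. For $\theta\in(0,\pi)$ put $A=A(\theta):=1-\log\bigl(2\cos(\theta/2)\bigr)$ and $\beta=\beta(\theta):=\theta/2$, and let $d(\theta):=a^2+\dfrac{1-2aA}{A^2+\beta^2}$. Then the following hold. (1) For $0<a<\frac{1}{1-\log 2}$, $\{w\in\mathbb{C}:|w-a|<r_a\}\subset B(\mathbb{D})$, where $$r_a=\begin{cases}\sqrt{d(\theta_a)}, & 0<a<\dfrac{2-\log 2}{(1-\log 2)(3-\log 2)},\\[2mm] \dfrac{1}{1-\log 2}-a, & \dfrac{2-\log 2}{(1-\log 2)(3-\log 2)}\le a<\dfrac{1}{1-\log 2},\end{cases}$$ and $\theta_a\in(0,\pi)$ is the root of the equation $$\sin\beta\,\bigl(a(A^2-\beta^2)-A\bigr)+\beta\cos\beta\,(2aA-1)=0 .$$ (2) For $0<a<\frac{1}{1-\log 2}$, $B(\mathbb{D})\subset\{w\in\mathbb{C}:|w-a|<R_a\}$, where $$R_a=\begin{cases}\dfrac{1}{1-\log 2}-a, & 0<a<\dfrac{1}{2(1-\log 2)},\\[2mm] a, & \dfrac{1}{2(1-\log 2)}\le a<\dfrac{1}{1-\log 2}.\end{cases}$$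
   Context: $\mathbb{D}=\{z\in\mathbb{C}:|z|<1\}$ and $\log$ denotes the principal branch of the logarithm. The quantity $d(\theta)$ is the square of the distance from the point $a$ on the real axis to the boundary point $B(e^{i\theta})$ of $B(\mathbb{D})$. *)

(* Defs.v *)
From Stdlib Require Import Reals Ensembles.
From Coquelicot Require Import Coquelicot.
Open Scope R_scope.

(* Principal argument, with values in (-PI, PI] for z <> 0; z = 0 gives a
   meaningless value. *)
Definition Arg (z : C) : R :=
  if Rle_dec 0 (Im z) then acos (Re z / Cmod z) else - acos (Re z / Cmod z).

Definition Clog (z : C) : C := (ln (Cmod z), Arg z).

(* Coquelicot's [ball] on C is a square (product metric), hence [Cmod] here. *)
Definition disk (c : C) (r : R) : Ensemble C :=
  fun w => Cmod (Cminus w c) < r.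

Definition unit_disk : Ensemble C := fun z => Cmod z < 1.

Definition B (z : C) : C :=
  Cdiv (RtoC 1) (Cminus (RtoC 1) (Clog (Cplus (RtoC 1) z))).

Definition image_B : Ensemble C :=
  fun w => exists z : C, In C unit_disk z /\ w = B z.

Definition A (theta : R) : R := 1 - ln (2 * cos (theta / 2)).

Definition beta (theta : R) : R := theta / 2.

Definition d (a theta : R) : R :=
  a ^ 2 + (1 - 2 * a * A theta) / (A theta ^ 2 + beta theta ^ 2).

Definition is_root (a theta : R) : Prop :=
  0 < theta < PI /\
  sin (beta theta) * (a * (A theta ^ 2 - beta theta ^ 2) - A theta)
    + beta theta * cos (beta theta) * (2 * a * A theta - 1) = 0.

(* Main.v *)
(** With [u = x + i y = 1/w], the image [B(D)] becomes the region
    [x > h(y) = 1 - ln (2 cos y)], [|y| < pi/2], and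
    [|w - a|^2 - a^2 = (1 - 2 a x) / (x^2 + y^2)]. On the boundary curve the derivative
    of this quantity has the sign of [a f - 1], where
    [f = ((h^2 - y^2) sin y + 2 y h cos y) / (h sin y + y cos y)]. Since
    [f' = (h^2 + y^2) (sin y - y cos y) / (cos y (h sin y + y cos y)^2) > 0],
    [f] increases from [(1 - ln 2)(3 - ln 2) / (2 - ln 2)] to infinity: either
    [f = 1/a] at exactly one point, the minimum of the distance, or [f > 1/a]
    throughout and the minimum is at [y = 0]. The second part only uses
    [x > 1 - ln 2]. *)

Require Import Defs.
From Stdlib Require Import Reals Ensembles Lra Ranalysis5.
From Coquelicot Require Import Coquelicot.
Open Scope R_scope.

(** * The boundary curve of the inverted image *)

(** Since 1 + e^(2ib) = 2 cos b e^(ib), the point [profile b - i b] is 1/B(e^(2ib)), and [A theta]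
    is [profile (theta / 2)]. *)
Definition profile (b : R) : R := 1 - ln (2 * cos b).

Lemma ln2_bounds : 0 < ln 2 < 1.
Proof.
  split.
  - rewrite <- ln_1; apply ln_increasing; lra.
  - replace 1 with (ln (exp 1)) by apply ln_exp.
    apply ln_increasing; [lra|].
    pose proof (exp_ineq1 1); lra.
Qed.

Lemma cos_pos (b : R) : 0 <= b < PI / 2 -> 0 < cos b.
Proof. intros; apply cos_gt_0; lra. Qed.

Lemma profile_0 : profile 0 = 1 - ln 2.
Proof. unfold profile; rewrite cos_0; f_equal; f_equal; ring. Qed.

Lemma profile_ge (b : R) : 0 <= b < PI / 2 -> 1 - ln 2 <= profile b.
Proof.
  intros Hb; unfold profile.
  pose proof (cos_pos b Hb).
  pose proof (COS_bound b).
  assert (ln (2 * cos b) <= ln 2) by (apply ln_le; lra).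
  lra.
Qed.

Lemma profile_pos (b : R) : 0 <= b < PI / 2 -> 0 < profile b.
Proof. intros Hb; pose proof (profile_ge b Hb); pose proof ln2_bounds; lra. Qed.

Lemma profile_onto (c : R) :
  1 - ln 2 <= c -> exists b, 0 <= b < PI / 2 /\ profile b = c.
Proof.
  intros Hc.
  pose proof (exp_pos (1 - c)) as He.
  assert (He2 : exp (1 - c) <= 2).
  { rewrite <- (exp_ln 2) by lra. destruct (Req_dec (1 - c) (ln 2)) as [->|]; [lra|].
    left; apply exp_increasing; lra. }
  exists (acos (exp (1 - c) / 2)).
  assert (Hcos : cos (acos (exp (1 - c) / 2)) = exp (1 - c) / 2) by (apply cos_acos; lra).
  pose proof (acos_bound (exp (1 - c) / 2)).
  split.
  - split; [lra|].
    destruct (Rlt_le_dec (acos (exp (1 - c) / 2)) (PI / 2)) as [|Hge]; [easy|].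
    assert (cos (acos (exp (1 - c) / 2)) <= 0) by (apply cos_le_0; lra).
    lra.
  - unfold profile; rewrite Hcos.
    replace (2 * (exp (1 - c) / 2)) with (exp (1 - c)) by field.
    rewrite ln_exp; ring.
Qed.

Lemma profile_increasing (b c : R) :
  0 <= b -> b < c -> c < PI / 2 -> profile b < profile c.
Proof.
  intros H0 Hbc Hc; unfold profile.
  assert (0 < cos c) by (apply cos_pos; lra).
  assert (cos c < cos b) by (apply cos_decreasing_1; lra).
  assert (ln (2 * cos c) < ln (2 * cos b)) by (apply ln_increasing; lra).
  lra.
Qed.

Lemma is_derive_profile (b : R) :
  0 <= b < PI / 2 -> is_derive profile b (sin b / cos b).
Proof.
  intros Hb; pose proof (cos_pos b Hb).
  unfold profile; auto_derive; [lra|field; lra].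
Qed.

(** Positivity is asked only on the open interval, because the derivatives it serves vanish at
    endpoints such as b = 0 or the critical point. *)
Lemma increasing_of_derive (f f' : R -> R) (x y : R) :
  x < y ->
  (forall c, x <= c <= y -> is_derive f c (f' c)) ->
  (forall c, x < c < y -> 0 < f' c) -> f x < f y.
Proof.
  intros Hxy Hd Hpos.
  destruct (MVT_cor2 f f' x y Hxy) as [c [Hc Hin]].
  { intros c Hc; apply is_derive_Reals, Hd, Hc. }
  specialize (Hpos c Hin); nra.
Qed.

Lemma sin_gt_mul_cos (b : R) : 0 < b < PI / 2 -> b * cos b < sin b.
Proof.
  intros Hb.
  assert (sin 0 - 0 * cos 0 < sin b - b * cos b) as H.
  { apply (increasing_of_derive (fun t => sin t - t * cos t) (fun t => t * sin t)).
    - lra.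
    - intros c _; auto_derive; [easy|ring].
    - intros c Hc; apply Rmult_lt_0_compat; [lra|apply sin_gt_0; lra]. }
  rewrite sin_0 in H; lra.
Qed.

(** * The critical-point ratio and its monotonicity *)

(** With u = [profile b + i b], this is Im(u^2 e^(ib)), and [denom b] is Im(u e^(ib)). The squared
    distance to a has derivative a positive multiple of [a * numer b - denom b]. *)
Definition numer (b : R) : R :=
  sin b * (profile b ^ 2 - b ^ 2) + 2 * b * cos b * profile b.

Definition denom (b : R) : R := profile b * sin b + b * cos b.

Lemma denom_pos (b : R) : 0 < b < PI / 2 -> 0 < denom b.
Proof.
  intros Hb; unfold denom.
  assert (0 < cos b) by (apply cos_pos; lra).
  assert (0 < sin b) by (apply sin_gt_0; lra).
  assert (0 < profile b) by (apply profile_pos; lra).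
  nra.
Qed.

Lemma is_derive_numer (b : R) : 0 <= b < PI / 2 ->
  is_derive numer b
    (cos b * (profile b ^ 2 - b ^ 2)
     + sin b * (2 * profile b * (sin b / cos b) - 2 * b)
     + 2 * cos b * profile b - 2 * b * sin b * profile b + 2 * b * sin b).
Proof.
  intros Hb; pose proof (cos_pos b Hb); pose proof (is_derive_profile b Hb) as Hp.
  unfold numer; auto_derive.
  - repeat split; try (eexists; exact Hp).
  - rewrite (is_derive_unique (fun x : R => profile x) _ _ Hp); field; lra.
Qed.

Lemma is_derive_denom (b : R) : 0 <= b < PI / 2 ->
  is_derive denom b
    (sin b * (sin b / cos b) + profile b * cos b + cos b - b * sin b).
Proof.
  intros Hb; pose proof (cos_pos b Hb); pose proof (is_derive_profile b Hb) as Hp.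
  unfold denom; auto_derive.
  - repeat split; try (eexists; exact Hp).
  - rewrite (is_derive_unique (fun x : R => profile x) _ _ Hp); field; lra.
Qed.

Definition ratio (b : R) : R := numer b / denom b.

Lemma ratio_lt_iff (b c : R) :
  0 < b < PI / 2 -> ratio b < c <-> numer b < c * denom b.
Proof. intros Hb; apply Rlt_div_l, denom_pos, Hb. Qed.

Lemma ratio_gt_iff (b c : R) :
  0 < b < PI / 2 -> c < ratio b <-> c * denom b < numer b.
Proof. intros Hb; symmetry; apply Rlt_div_r, denom_pos, Hb. Qed.

Lemma is_derive_ratio (b : R) : 0 < b < PI / 2 ->
  is_derive ratio b
    ((profile b ^ 2 + b ^ 2) * (sin b - b * cos b) / (cos b * denom b ^ 2)).
Proof.
  intros Hb.
  assert (Hb' : 0 <= b < PI / 2) by lra.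
  pose proof (cos_pos b Hb') as Hc; pose proof (denom_pos b Hb) as Hd.
  evar_last.
  - apply is_derive_div; [apply is_derive_numer, Hb'|apply is_derive_denom, Hb'|lra].
  - unfold minus, plus, opp, mult, scal; simpl; unfold mult; simpl.
    (* The quotient rule yields an expression homogeneous in [sin b], [cos b]. *)
    pose proof (sin2_cos2 b) as Hsc; unfold Rsqr in Hsc.
    replace (sin b - b * cos b)
      with ((sin b - b * cos b) * (sin b * sin b + cos b * cos b)) by (rewrite Hsc; ring).
    clear Hsc.
    revert Hd; unfold numer, denom; intros Hd.
    field; lra.
Qed.

Lemma ratio_increasing (b c : R) :
  0 < b -> b < c -> c < PI / 2 -> ratio b < ratio c.
Proof.
  intros H0 Hbc Hc.
  eapply increasing_of_derive; [exact Hbc| |].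
  - intros x Hx; apply is_derive_ratio; lra.
  - intros x Hx; cbv beta.
    assert (Hx' : 0 < x < PI / 2) by lra.
    pose proof (denom_pos x Hx'); pose proof (sin_gt_mul_cos x Hx').
    assert (0 < cos x) by (apply cos_pos; lra).
    assert (0 < profile x) by (apply profile_pos; lra).
    apply Rdiv_lt_0_compat; [apply Rmult_lt_0_compat; nra|].
    apply Rmult_lt_0_compat; [lra|apply pow_lt; lra].
Qed.

(** * Behaviour of the ratio near 0 and its range *)

Lemma pos_near_0_of_derive (f : R -> R) (l : R) :
  f 0 = 0 -> is_derive f 0 l -> 0 < l ->
  exists e, 0 < e /\ forall x, 0 < x < e -> 0 < f x.
Proof.
  intros Hf0 Hf Hl.
  apply is_derive_Reals in Hf.
  destruct (Hf (l / 2) ltac:(lra)) as [[e He] Hdel]; simpl in Hdel.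
  exists e; split; [easy|]; intros x Hx.
  specialize (Hdel x ltac:(lra)).
  rewrite Rabs_pos_eq in Hdel by lra.
  specialize (Hdel ltac:(lra)).
  rewrite Rplus_0_l, Hf0 in Hdel.
  apply Rabs_lt_between in Hdel.
  replace (f x) with ((f x - 0) / x * x) by (field; lra).
  apply Rmult_lt_0_compat; lra.
Qed.

(* The limit of [ratio] at 0 (where [ratio 0] itself is the junk value 0/0). *)
Definition ratio0 : R := (1 - ln 2) * (3 - ln 2) / (2 - ln 2).

(** At 0 the derivatives of [numer] and [denom] are (1 - ln 2)(3 - ln 2) and 2 - ln 2. The factor
    [e], taken as 1 or -1, lets one positivity lemma compare the ratio with c on either side, in
    place of a limit of 0/0. *)
Lemma is_derive_combination_0 (c e : R) :
  is_derive (fun b => e * (numer b - c * denom b)) 0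
    (e * (2 - ln 2) * (ratio0 - c)).
Proof.
  pose proof ln2_bounds; pose proof PI_RGT_0.
  assert (Hz : 0 <= 0 < PI / 2) by lra.
  pose proof (is_derive_numer 0 Hz) as Hn; pose proof (is_derive_denom 0 Hz) as Hd.
  auto_derive.
  - repeat split; eexists; eassumption.
  - rewrite (is_derive_unique (fun x : R => numer x) _ _ Hn).
    rewrite (is_derive_unique (fun x : R => denom x) _ _ Hd).
    rewrite sin_0, cos_0, profile_0; unfold ratio0; field; lra.
Qed.

Lemma combination_0 (c : R) : numer 0 - c * denom 0 = 0.
Proof. unfold numer, denom; rewrite sin_0; ring. Qed.

Lemma ratio_lt_near_0 (c : R) :
  ratio0 < c -> exists b, 0 < b < PI / 2 /\ ratio b < c.
Proof.
  intros Hc; pose proof ln2_bounds; pose proof PI_RGT_0.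
  destruct (pos_near_0_of_derive (fun b => -1 * (numer b - c * denom b)) (-1 * (2 - ln 2) * (ratio0 - c)))
    as [e [He Hpos]].
  - rewrite combination_0; ring.
  - apply is_derive_combination_0.
  - nra.
  - assert (0 < Rmin e (PI / 2)) by (apply Rmin_glb_lt; lra).
    pose proof (Rmin_l e (PI / 2)); pose proof (Rmin_r e (PI / 2)).
    exists (Rmin e (PI / 2) / 2).
    assert (Hb : 0 < Rmin e (PI / 2) / 2 < PI / 2) by lra.
    split; [exact Hb|].
    specialize (Hpos (Rmin e (PI / 2) / 2) ltac:(lra)).
    apply ratio_lt_iff; [exact Hb|lra].
Qed.

(** If c = [ratio (b / 2)] were below [ratio0], the ratio would exceed c close to 0, against
    monotonicity. Halving b turns the resulting weak inequality into a strict one. *)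
Lemma ratio_gt_ratio0 (b : R) : 0 < b < PI / 2 -> ratio0 < ratio b.
Proof.
  intros Hb; pose proof ln2_bounds.
  apply Rle_lt_trans with (ratio (b / 2)); [|apply ratio_increasing; lra].
  apply Rnot_lt_le; intros Hlt.
  set (c := ratio (b / 2)) in *.
  destruct (pos_near_0_of_derive (fun t => 1 * (numer t - c * denom t)) (1 * (2 - ln 2) * (ratio0 - c)))
    as [e [He Hpos]].
  - rewrite combination_0; ring.
  - apply is_derive_combination_0.
  - nra.
  - assert (0 < Rmin e (b / 2)) by (apply Rmin_glb_lt; lra).
    pose proof (Rmin_l e (b / 2)); pose proof (Rmin_r e (b / 2)).
    set (t := Rmin e (b / 2) / 2).
    assert (Ht : 0 < t /\ t < e /\ t < b / 2) by (unfold t; lra).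
    specialize (Hpos t ltac:(lra)).
    assert (Hlt2 : ratio t < c) by (apply ratio_increasing; lra).
    apply ratio_lt_iff in Hlt2; lra.
Qed.

(** Shows that the ratio grows at least like [profile b - 3]; the bound 3 on the profile ensures 3 p
    > b^2, as b < 2. *)
Lemma numer_ge (b : R) : 0 < b < PI / 2 -> 3 <= profile b ->
  (profile b - 3) * denom b <= numer b.
Proof.
  intros Hb Hp.
  pose proof PI_4.
  assert (0 < cos b) by (apply cos_pos; lra).
  assert (0 < sin b) by (apply sin_gt_0; lra).
  assert (b < 2) by lra.
  unfold numer, denom.
  set (p := profile b) in *; set (s := sin b) in *; set (c := cos b) in *.
  (* The difference is [s (3 p - b^2) + b c (p + 3)]. *)
  assert (0 <= s * (3 * p - b ^ 2)) by (apply Rmult_le_pos; nra).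
  assert (0 <= b * c * (p + 3)) by (apply Rmult_le_pos; nra).
  nra.
Qed.

Lemma ratio_unbounded (c : R) : 0 < c -> exists b, 0 < b < PI / 2 /\ c < ratio b.
Proof.
  intros Hc; pose proof ln2_bounds.
  (* With this profile value the ratio is at least c + 1. *)
  destruct (profile_onto (c + 4) ltac:(lra)) as [b [Hb Hp]].
  assert (Hb0 : 0 < b).
  { destruct (Req_dec b 0) as [->|]; [|lra].
    rewrite profile_0 in Hp; lra. }
  exists b; split; [lra|].
  assert (Hd : 0 < denom b) by (apply denom_pos; lra).
  pose proof (numer_ge b ltac:(lra) ltac:(lra)) as Hn.
  apply ratio_gt_iff; [lra|rewrite Hp in Hn; nra].
Qed.

Lemma ratio_onto (c : R) :
  ratio0 < c -> exists b, 0 < b < PI / 2 /\ ratio b = c.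
Proof.
  intros Hc; pose proof ln2_bounds.
  assert (0 < ratio0) by (apply Rdiv_lt_0_compat; [apply Rmult_lt_0_compat|]; lra).
  destruct (ratio_lt_near_0 c Hc) as [x [Hx Hxc]].
  destruct (ratio_unbounded c ltac:(lra)) as [y [Hy Hyc]].
  assert (Hxy : x < y).
  { destruct (Rtotal_order x y) as [|[->|Hyx]]; [easy|lra|].
    pose proof (ratio_increasing y x ltac:(lra) Hyx ltac:(lra)); lra. }
  destruct (IVT_interv (fun b => ratio b - c) x y) as [z [Hz Hrz]]; try lra.
  - intros t Ht.
    apply continuity_pt_minus; [|apply continuity_pt_const; easy].
    apply continuity_pt_filterlim, (ex_derive_continuous ratio).
    eexists; apply is_derive_ratio; lra.
  - exists z; split; lra.
Qed.

(** * Distance from a along the boundary *)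

(* [boundary_dist a b = |1/u - a|^2 - a^2] for the point [u = profile b + i b]. *)
Definition boundary_dist (a b : R) : R :=
  (1 - 2 * a * profile b) / (profile b ^ 2 + b ^ 2).

Definition boundary_dist' (a b : R) : R :=
  2 * (a * numer b - denom b) / (cos b * (profile b ^ 2 + b ^ 2) ^ 2).

Lemma is_derive_boundary_dist (a b : R) :
  0 <= b < PI / 2 -> is_derive (boundary_dist a) b (boundary_dist' a b).
Proof.
  intros Hb; pose proof (cos_pos b Hb); pose proof (profile_pos b Hb).
  pose proof (is_derive_profile b Hb) as Hp.
  assert (0 < profile b ^ 2 + b ^ 2) by nra.
  unfold boundary_dist; auto_derive.
  - repeat split; try (eexists; exact Hp); nra.
  - rewrite (is_derive_unique (fun x : R => profile x) _ _ Hp).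
    unfold boundary_dist', numer, denom; field; lra.
Qed.

Lemma boundary_dist'_pos (a b : R) :
  0 < a -> 0 < b < PI / 2 -> / a < ratio b -> 0 < boundary_dist' a b.
Proof.
  intros Ha Hb Hr.
  pose proof (denom_pos b Hb).
  assert (0 < cos b) by (apply cos_pos; lra).
  assert (0 < profile b) by (apply profile_pos; lra).
  apply ratio_gt_iff in Hr; [|easy].
  apply (Rmult_lt_compat_l a) in Hr; [|easy].
  rewrite <- Rmult_assoc, Rinv_r in Hr by lra.
  apply Rdiv_lt_0_compat; [lra|].
  apply Rmult_lt_0_compat; [easy|apply pow_lt; nra].
Qed.

Lemma boundary_dist'_neg (a b : R) :
  0 < a -> 0 < b < PI / 2 -> ratio b < / a -> boundary_dist' a b < 0.
Proof.
  intros Ha Hb Hr.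
  pose proof (denom_pos b Hb).
  assert (0 < cos b) by (apply cos_pos; lra).
  assert (0 < profile b) by (apply profile_pos; lra).
  apply ratio_lt_iff in Hr; [|easy].
  apply (Rmult_lt_compat_l a) in Hr; [|easy].
  rewrite <- Rmult_assoc, Rinv_r in Hr by lra.
  apply Rdiv_neg_pos; [lra|].
  apply Rmult_lt_0_compat; [easy|apply pow_lt; nra].
Qed.

Lemma boundary_dist_increasing (a x y : R) :
  0 < a -> 0 <= x -> x < y -> y < PI / 2 ->
  (forall b, x < b < y -> / a < ratio b) ->
  boundary_dist a x < boundary_dist a y.
Proof.
  intros Ha Hx Hxy Hy Hr.
  apply (increasing_of_derive _ (boundary_dist' a)); [easy| |].
  - intros c Hc; apply is_derive_boundary_dist; lra.
  - intros c Hc; apply boundary_dist'_pos; [easy|lra|auto].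
Qed.

Lemma boundary_dist_decreasing (a x y : R) :
  0 < a -> 0 <= x -> x < y -> y < PI / 2 ->
  (forall b, x < b < y -> ratio b < / a) ->
  boundary_dist a y < boundary_dist a x.
Proof.
  intros Ha Hx Hxy Hy Hr.
  apply Ropp_lt_cancel.
  apply (increasing_of_derive (fun b => - boundary_dist a b) (fun b => - boundary_dist' a b));
    [easy| |].
  - intros c Hc; apply (is_derive_opp (boundary_dist a)), is_derive_boundary_dist; lra.
  - intros c Hc; cbv beta.
    pose proof (boundary_dist'_neg a c Ha ltac:(lra) (Hr c Hc)); lra.
Qed.

(** The left side of the root equation is [a * numer - denom] at theta / 2, so roots are the
    critical points of the boundary distance. *)
Lemma is_root_iff (a theta : R) : 0 < a ->
  is_root a theta <-> 0 < theta < PI /\ ratio (theta / 2) = / a.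
Proof.
  intros Ha; unfold is_root, beta.
  change (A theta) with (profile (theta / 2)).
  split; intros [Ht H]; split; try easy;
    pose proof (denom_pos (theta / 2) ltac:(lra)) as Hd.
  - apply Rmult_eq_reg_r with (a * denom (theta / 2)); [|nra].
    unfold ratio; field_simplify; [|lra|lra].
    unfold numer, denom in *; lra.
  - assert (Hn : a * numer (theta / 2) = denom (theta / 2)).
    { replace (numer (theta / 2)) with (ratio (theta / 2) * denom (theta / 2))
        by (unfold ratio; field; lra).
      rewrite H; field; lra. }
    unfold numer, denom in Hn; lra.
Qed.

(** * Preimages under B and inclusions between disks and the image *)

(** Writing 1/w = x - iy, the equation B(z) = w is solved by 1 + z = e^(1-x) e^(iy) when |y| < pi/2;
    then |z| < 1 amounts to e^(1-x) < 2 cos y. *)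
Lemma image_B_of_inverse (p q : R) :
  0 < p ^ 2 + q ^ 2 ->
  - (PI / 2) < q / (p ^ 2 + q ^ 2) < PI / 2 ->
  exp (1 - p / (p ^ 2 + q ^ 2)) < 2 * cos (q / (p ^ 2 + q ^ 2)) ->
  image_B (p, q).
Proof.
  intros Hpos Hy Hx.
  set (x := p / (p ^ 2 + q ^ 2)) in *; set (y := q / (p ^ 2 + q ^ 2)) in *.
  set (e := exp (1 - x)) in *.
  assert (He : 0 < e) by apply exp_pos.
  pose proof (sin2_cos2 y) as Hsc; unfold Rsqr in Hsc.
  exists (e * cos y - 1, e * sin y); split.
  - unfold In, unit_disk, Cmod; simpl.
    assert (Hsq : (e * cos y - 1) * ((e * cos y - 1) * 1) + e * sin y * (e * sin y * 1)
                  = 1 + e * (e * (sin y * sin y + cos y * cos y) - 2 * cos y)) by ring.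
    apply Rlt_le_trans with (sqrt 1); [|rewrite sqrt_1; lra].
    apply sqrt_lt_1_alt; split.
    + exact (Rplus_le_le_0_compat _ _ (pow2_ge_0 (e * cos y - 1)) (pow2_ge_0 (e * sin y))).
    + rewrite Hsq, Hsc; nra.
  - assert (Hz : Cplus (RtoC 1) (e * cos y - 1, e * sin y) = (e * cos y, e * sin y)).
    { unfold Cplus, RtoC; simpl; f_equal; ring. }
    assert (Hm : Cmod (e * cos y, e * sin y) = e).
    { unfold Cmod; simpl.
      replace (_ + _) with (e * e * (sin y * sin y + cos y * cos y)) by ring.
      rewrite Hsc, Rmult_1_r; apply sqrt_square; lra. }
    assert (Harg : Arg (e * cos y, e * sin y) = y).
    { unfold Arg; rewrite Hm; simpl.
      replace (e * cos y / e) with (cos y) by (field; lra).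
      (* On |y| < pi/2 the signs of sin y and y agree, which selects the right branch of [Arg]. *)
      destruct (Rle_dec 0 (e * sin y)) as [Hs|Hs].
      - apply acos_cos.
        destruct (Rle_lt_dec 0 y); [lra|].
        assert (sin y < 0) by (apply sin_lt_0_var; lra); nra.
      - rewrite <- cos_neg, acos_cos; [ring|].
        destruct (Rle_lt_dec 0 y); [|lra].
        assert (0 <= sin y) by (apply sin_ge_0; lra); nra. }
    unfold B, Clog; rewrite Hz, Hm, Harg.
    unfold e; rewrite ln_exp.
    unfold x, y.
    unfold Cdiv, Cinv, Cmult, Cminus, Cplus, Copp, RtoC; simpl.
    f_equal; field; lra.
Qed.

(* In terms of [u = x + i y = 1/w], the disk is
   [1 - 2 a x - m (x^2 + y^2) < 0], a disk centred at [c = a / (-m)]; the domain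
   [1/B(D)] is [x > profile y]. A point of the disk outside the domain moves, within
   the disk, either right onto the boundary curve or to abscissa [c] and then
   vertically onto the curve. *)
Lemma disk_in_image_B (a m r : R) :
  0 < a < 1 / (1 - ln 2) -> - a ^ 2 <= m < 0 -> 0 <= r -> r ^ 2 <= a ^ 2 + m ->
  (forall b, 0 <= b < PI / 2 -> m <= boundary_dist a b) ->
  Included C (disk (RtoC a) r) image_B.
Proof.
  intros [Ha Ha'] [Hm Hm0] Hr Hrm Hbd [p q] Hw.
  pose proof ln2_bounds.
  apply Rlt_div_r in Ha'; [|lra].
  (* No point of the boundary curve lies in the inverted open disk. *)
  assert (HF : forall b, 0 <= b < PI / 2 ->
            0 <= 1 - 2 * a * profile b - m * (profile b ^ 2 + b ^ 2)).
  { intros b Hb; specialize (Hbd b Hb).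
    pose proof (profile_pos b Hb).
    apply Rle_div_r in Hbd; [lra|nra]. }
  unfold In, disk, Cmod in Hw; simpl in Hw.
  assert (Hd : (p - a) ^ 2 + q ^ 2 < a ^ 2 + m).
  { apply Rlt_le_trans with (r ^ 2); [|easy].
    assert (H0 : 0 <= (p - a) ^ 2 + q ^ 2)
      by exact (Rplus_le_le_0_compat _ _ (pow2_ge_0 _) (pow2_ge_0 _)).
    rewrite <- (pow2_sqrt _ H0).
    replace ((p + - a) * ((p + - a) * 1) + (q + - 0) * ((q + - 0) * 1))
      with ((p - a) ^ 2 + q ^ 2) in Hw by ring.
    pose proof (sqrt_pos ((p - a) ^ 2 + q ^ 2)); nra. }
  (* The origin is outside the disk because m < 0. *)
  assert (Hn : 0 < p ^ 2 + q ^ 2) by nra.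
  set (n := p ^ 2 + q ^ 2) in *.
  set (x := p / n); set (y := q / n).
  assert (Hxy : 1 - 2 * a * x - m * (x ^ 2 + y ^ 2) < 0).
  { replace (1 - 2 * a * x - m * (x ^ 2 + y ^ 2)) with ((n - 2 * a * p - m) / n)
      by (unfold x, y, n; field; unfold n in Hn; lra).
    apply Rdiv_neg_pos; [unfold n; lra|easy]. }
  set (c := a / - m).
  assert (Hac : a = c * - m) by (unfold c; field; lra).
  (* From -m <= a^2 follows c >= 1/a > 1 - ln 2. *)
  assert (Hc : 1 - ln 2 <= c).
  { apply Rle_div_r; [lra|nra]. }
  clearbody c.
  assert (Hcy : forall y', y' ^ 2 <= y ^ 2 -> 1 - 2 * a * c - m * (c ^ 2 + y' ^ 2) < 0).
  { intros y' Hy'.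
    assert (0 <= - m * (x - c) ^ 2) by (apply Rmult_le_pos; [lra|apply pow2_ge_0]).
    assert (0 <= - m * (y ^ 2 - y' ^ 2)) by (apply Rmult_le_pos; lra).
    rewrite Hac in Hxy |- *; lra. }
  destruct (profile_onto c Hc) as [b [Hb Hpb]].
  (* Otherwise the curve point (c, b) would lie in the disk, against [HF]. *)
  assert (Hyb : Rabs y < b).
  { apply Rnot_le_lt; intros Hle.
    pose proof (HF b Hb) as HFb; rewrite Hpb in HFb.
    assert (b ^ 2 <= y ^ 2) by (rewrite <- (pow2_abs y); apply pow_incr; lra).
    specialize (Hcy b ltac:(easy)); lra. }
  pose proof (Rabs_pos y) as Hy0.
  assert (Hpc : profile (Rabs y) < c)
    by (rewrite <- Hpb; apply profile_increasing; lra).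
  assert (Hpx : profile (Rabs y) < x).
  { apply Rnot_le_lt; intros Hle.
    pose proof (HF (Rabs y) ltac:(lra)) as HFy; rewrite pow2_abs in HFy.
    (* The product is (x - c)^2 - (profile |y| - c)^2: moving right to the curve does not increase
       the distance to the centre. *)
    assert (0 <= - m * ((profile (Rabs y) - x) * (2 * c - profile (Rabs y) - x))).
    { apply Rmult_le_pos; [lra|]; apply Rmult_le_pos; lra. }
    rewrite Hac in Hxy, HFy; lra. }
  apply image_B_of_inverse; [easy| |].
  - fold n y; pose proof (Rabs_lt_between y (PI / 2)) as Hi; apply Hi; lra.
  - fold n x y.
    replace (cos y) with (cos (Rabs y))
      by (unfold Rabs; destruct (Rcase_abs y); [apply cos_neg|easy]).
    unfold profile in Hpx.
    assert (0 < cos (Rabs y)) by (apply cos_pos; lra).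
    rewrite <- (exp_ln (2 * cos (Rabs y))) by lra.
    apply exp_increasing; lra.
Qed.

(** Only |1 + z| < 2 is retained, which places 1/w in the half-plane x > 1 - ln 2. *)
Lemma image_B_inverse (w : C) : image_B w ->
  exists x y, 1 - ln 2 < x /\ w = (x / (x ^ 2 + y ^ 2), y / (x ^ 2 + y ^ 2)).
Proof.
  intros [z [Hz ->]]; unfold In, unit_disk in Hz.
  pose proof ln2_bounds.
  set (v := Cplus (RtoC 1) z).
  assert (Hv : 0 < Cmod v < 2).
  { pose proof (Cmod_triangle (RtoC 1) z) as Ht.
    rewrite Cmod_1 in Ht; fold v in Ht.
    (* From v - z = 1 follows |v| >= 1 - |z| > 0, so the logarithm of |v| is meaningful. *)
    pose proof (Cmod_triangle v (Copp z)) as Ht'.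
    rewrite Cmod_opp in Ht'.
    replace (Cplus v (Copp z)) with (RtoC 1) in Ht' by (unfold v; ring).
    rewrite Cmod_1 in Ht'; lra. }
  assert (Hx : 1 - ln 2 < 1 - ln (Cmod v)).
  { pose proof (ln_increasing (Cmod v) 2 ltac:(lra) ltac:(lra)); lra. }
  exists (1 - ln (Cmod v)), (Arg v); split; [exact Hx|].
  unfold B, Clog; fold v.
  set (x := 1 - ln (Cmod v)) in *; set (y := Arg v).
  replace (Cminus (RtoC 1) (ln (Cmod v), y)) with (x, - y)
    by (unfold Cminus, Cplus, Copp, RtoC, x; simpl; f_equal; ring).
  unfold Cdiv, Cinv, Cmult, RtoC; simpl.
  f_equal; field; nra.
Qed.

(** For 1/w = x - iy, |w - a|^2 = a^2 + (1 - 2 a x)/(x^2 + y^2), so it suffices to bound the last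
    term by m on the half-plane. *)
Lemma image_B_in_disk (a m r : R) :
  0 <= r -> a ^ 2 + m <= r ^ 2 ->
  (forall x y, 1 - ln 2 < x -> 1 - 2 * a * x < m * (x ^ 2 + y ^ 2)) ->
  Included C image_B (disk (RtoC a) r).
Proof.
  intros Hr Hm Hbd w Hw.
  pose proof ln2_bounds.
  destruct (image_B_inverse w Hw) as [x [y [Hx ->]]].
  specialize (Hbd x y Hx).
  assert (Hn : 0 < x ^ 2 + y ^ 2) by nra.
  unfold In, disk, Cmod; cbn [fst snd Cminus Cplus Copp RtoC].
  rewrite <- (sqrt_pow2 r Hr).
  assert (Hsq : (x / (x ^ 2 + y ^ 2) + - a) ^ 2 + (y / (x ^ 2 + y ^ 2) + - 0) ^ 2
                = a ^ 2 + (1 - 2 * a * x) / (x ^ 2 + y ^ 2)) by (field; lra).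
  apply sqrt_lt_1_alt; split.
  { exact (Rplus_le_le_0_compat _ _ (pow2_ge_0 _) (pow2_ge_0 _)). }
  rewrite Hsq.
  apply Rlt_div_l in Hbd; [lra|exact Hn].
Qed.

(** * The four cases of inner and outer radii *)

Theorem theorem2p6 :
  forall a : R, 0 < a < 1 / (1 - ln 2) ->
    ((a < (2 - ln 2) / ((1 - ln 2) * (3 - ln 2)) ->
        exists theta_a : R, unique (is_root a) theta_a /\
          Included C (disk (RtoC a) (sqrt (d a theta_a))) image_B) /\
     ((2 - ln 2) / ((1 - ln 2) * (3 - ln 2)) <= a ->
        Included C (disk (RtoC a) (1 / (1 - ln 2) - a)) image_B)) /\
    ((a < 1 / (2 * (1 - ln 2)) ->
        Included C image_B (disk (RtoC a) (1 / (1 - ln 2) - a))) /\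
     (1 / (2 * (1 - ln 2)) <= a ->
        Included C image_B (disk (RtoC a) a))).
Proof.
  intros a Ha; pose proof ln2_bounds as HL; pose proof PI_RGT_0.
  assert (Hthr : (2 - ln 2) / ((1 - ln 2) * (3 - ln 2)) = / ratio0)
    by (unfold ratio0; field; lra).
  assert (Hr0 : 0 < ratio0) by (apply Rdiv_lt_0_compat; [apply Rmult_lt_0_compat|]; lra).
  split; split.
  - rewrite Hthr; intros Hlt.
    assert (Hinv : ratio0 < / a).
    { rewrite <- (Rinv_inv ratio0); apply Rinv_lt_contravar; [|exact Hlt].
      apply Rmult_lt_0_compat; [lra|apply Rinv_0_lt_compat, Hr0]. }
    destruct (ratio_onto (/ a) Hinv) as [b [Hb Hrb]].
    exists (2 * b); split; [split|].
    + apply is_root_iff; [lra|]; split; [lra|].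
      replace (2 * b / 2) with b by field; exact Hrb.
    + intros t Ht; apply is_root_iff in Ht; [|lra].
      destruct Ht as [Ht Hrt].
      destruct (Rtotal_order b (t / 2)) as [Hlt'|[Heq|Hlt']]; [|lra|].
      * pose proof (ratio_increasing b (t / 2) ltac:(lra) Hlt' ltac:(lra)); lra.
      * pose proof (ratio_increasing (t / 2) b ltac:(lra) Hlt' ltac:(lra)); lra.
    + assert (Hd : d a (2 * b) = a ^ 2 + boundary_dist a b).
      { unfold d, beta; change (A (2 * b)) with (profile (2 * b / 2)).
        replace (2 * b / 2) with b by field; reflexivity. }
      assert (Hmin : forall t, 0 <= t < PI / 2 -> boundary_dist a b <= boundary_dist a t).
      { intros t Ht.
        destruct (Rtotal_order b t) as [Hlt'|[->|Hlt']]; [|lra|].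
        - left; apply boundary_dist_increasing; try lra.
          intros s Hs; rewrite <- Hrb; apply ratio_increasing; lra.
        - left; apply boundary_dist_decreasing; try lra.
          intros s Hs; rewrite <- Hrb; apply ratio_increasing; lra. }
      (* After clearing denominators this is (1 - a p)^2 + (a b)^2 >= 0 with p = [profile b]. *)
      assert (Hge : - a ^ 2 <= boundary_dist a b).
      { pose proof (profile_pos b ltac:(lra)).
        unfold boundary_dist; apply Rle_div_r; [nra|].
        pose proof (pow2_ge_0 (1 - a * profile b)).
        pose proof (pow2_ge_0 (a * b)); nra. }
      assert (Hneg : boundary_dist a b < 0).
      { pose proof (Rinv_0_lt_compat a ltac:(lra)).
        (* At this point of the curve the numerator is -1 - 2a, so the minimum is negative too. *)
        destruct (profile_onto (/ a + 1) ltac:(lra)) as [t [Ht Hpt]].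
        apply Rle_lt_trans with (boundary_dist a t); [apply Hmin, Ht|].
        unfold boundary_dist; rewrite Hpt.
        apply Rdiv_neg_pos; [|nra].
        replace (2 * a * (/ a + 1)) with (2 + 2 * a) by (field; lra); lra. }
      apply (disk_in_image_B a (boundary_dist a b)); try easy.
      * apply sqrt_pos.
      * rewrite pow2_sqrt, Hd; lra.
  - rewrite Hthr; intros Hge.
    assert (Hinv : / a <= ratio0).
    { rewrite <- (Rinv_inv ratio0); apply Rinv_le_contravar; [|exact Hge].
      apply Rinv_0_lt_compat, Hr0. }
    (* The threshold exceeds 1/(2(1 - ln 2)) because 2(2 - ln 2) > 3 - ln 2; this makes the value at
       b = 0 negative. *)
    assert (H2a : 1 < 2 * a * (1 - ln 2)).
    { apply Rmult_le_compat_l with (r := a) in Hinv; [|lra].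
      rewrite Rinv_r in Hinv by lra; unfold ratio0 in Hinv.
      replace (a * ((1 - ln 2) * (3 - ln 2) / (2 - ln 2)))
        with (a * (1 - ln 2) * (3 - ln 2) / (2 - ln 2)) in Hinv by (field; lra).
      apply Rle_div_r in Hinv; [nra|lra]. }
    assert (Hd0 : boundary_dist a 0 = (1 / (1 - ln 2) - a) ^ 2 - a ^ 2).
    { unfold boundary_dist; rewrite profile_0; field; lra. }
    apply (disk_in_image_B a (boundary_dist a 0)); try lra.
    + split; [rewrite Hd0; nra|].
      unfold boundary_dist; rewrite profile_0; apply Rdiv_neg_pos; [lra|nra].
    + intros b Hb.
      destruct (Req_dec b 0) as [->|]; [lra|].
      left; apply boundary_dist_increasing; try lra.
      intros s Hs; pose proof (ratio_gt_ratio0 s ltac:(lra)); lra.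
  - intros Hlt.
    assert (H2a : 2 * a * (1 - ln 2) < 1).
    { apply Rlt_div_r in Hlt; lra. }
    (* This is [boundary_dist a 0], so a^2 + m is the square of the radius. *)
    set (m := (1 - 2 * a * (1 - ln 2)) / (1 - ln 2) ^ 2).
    assert (Hm : 0 < m) by (apply Rdiv_lt_0_compat; [lra|apply pow_lt; lra]).
    apply (image_B_in_disk a m).
    + lra.
    + right; unfold m; field; lra.
    + intros x y Hx.
      assert (Hm' : m * (1 - ln 2) ^ 2 = 1 - 2 * a * (1 - ln 2)) by (unfold m; field; lra).
      assert ((1 - ln 2) ^ 2 <= x ^ 2 + y ^ 2) by nra.
      nra.
  - intros Hge.
    assert (H2a : 1 <= 2 * a * (1 - ln 2)).
    { apply Rle_div_l in Hge; lra. }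
    (* With m = 0 the circle passes through the origin and inverts to the line x = 1/(2a), where
       1/(2a) <= 1 - ln 2. *)
    apply (image_B_in_disk a 0); [lra|lra|].
    intros x y Hx; nra.
Qed.
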